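(* Let $q$ be an odd prime, let $B=\{b_1,b_2,\ldots,b_l\}$ be a finite set of nonzero integers, let $(a_j)_{j=1}^{l}\in(\mathbb{F}_q\setminus\{0\})^l$, and let $B':=\{b_j^{a_j}:1\le j\le l\}$. Then $B$ satisfies the conditions below if and only if $B'$ satisfies them; that is, for each of the following conditions on a finite set $C$ of nonzero integers, the condition holds for $C=B$ if and only if it holds for $C=B'$: (1) $C$ contains a $q^{th}$ power modulo almost every prime; (2) for every prime $p\neq q$ not dividing $\prod_{c\in C}c$, the set $C$ contains a $q^{th}$ power modulo $p$; (3) $k\ge2$ and the set of hyperplanes in $\mathbb{F}_q^k$ associated with $C$ contains a linear covering of $\mathbb{F}_q^k$.
   Context: In the exponent, $a_j\in\mathbb{F}_q\setminus\{0\}$ is identified with its representative in $\{1,\ldots,q-1\}$. A set $C$ contains a $q^{th}$ power modulo a prime $p$ if there are $c\in C$ and $x\in\mathbb{Z}$ with $x^q\equiv c\pmod p$; ''modulo almost every prime'' means for all but finitely many primes $p$. For a positive integer $b=\prod_{i=1}^{m}r_i^{e_i}$ (prime factorization), its $q$-free part is $\mathrm{rad}_q(b):=\prod_{i=1}^m r_i^{e_i\bmod q}$ with $e_i\bmod q\in\{0,\ldots,q-1\}$. For a finite set $C$ of nonzero integers, let $p_1,\ldots,p_k$ be all the distinct primes dividing at least one of the integers $\mathrm{rad}_q(|c|)$, $c\in C$, and for $c\in C$ let $\nu_i(c)\ge0$ be the exact exponent of $p_i$ in $\mathrm{rad}_q(|c|)$. The set of hyperplanes in $\mathbb{F}_q^k$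 associated with $C$ is $\big\{\sum_{i=1}^k\nu_i(c)x_i=0: c\in C\big\}$, each equation being identified with its solution set in $\mathbb{F}_q^k$. A linear covering of a vector space $V$ of dimension at least $2$ is a collection of proper linear subspaces of $V$ whose union is $V$. *)

(* Defs.v *)
From mathcomp Require Import all_boot all_order all_algebra.
From mathcomp Require Import finmap.

Set Implicit Arguments.
Unset Strict Implicit.
Unset Printing Implicit Defensive.

Import GRing.Theory.
Local Open Scope ring_scope.

Definition contains_qth_power_mod (q : nat) (C : {fset int}) (p : nat) : Prop :=
  exists2 c : int, c \in C & exists x : int, (x ^+ q = c %[mod p])%Z.

Definition almost_every_prime (P : nat -> Prop) : Prop :=
  exists E : {fset nat}, forall p : nat, prime p -> p \notin E -> P p.

Definition radq (q b : nat) : nat :=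
  (\prod_(r <- primes b) r ^ (logn r b %% q))%N.

(* The list p_1, ..., p_k; the order of enumeration is immaterial. *)
Definition rad_primes (q : nat) (C : {fset int}) : seq nat :=
  undup (flatten [seq primes (radq q `|c|%N) | c <- enum_fset C]).

Definition dimk (q : nat) (C : {fset int}) : nat := size (rad_primes q C).

Definition nu (q : nat) (C : {fset int}) (c : int) (i : 'I_(dimk q C)) : nat :=
  logn (nth 0%N (rad_primes q C) i) (radq q `|c|%N).

(* A set of subspaces of F_q^k is a predicate on {vspace 'rV['F_q]_k}.  When c
   is, up to sign, a q-th power, all nu_i(c) vanish and the associated
   "hyperplane" is the whole space. *)
Definition hyperplanes (q : nat) (C : {fset int})
    (U : {vspace 'rV['F_q]_(dimk q C)}) : Prop :=
  exists2 c : int, c \in C &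
    forall x : 'rV['F_q]_(dimk q C),
      x \in U <-> \sum_(i < dimk q C) (nu c i)%:R * x 0 i = 0.

Definition linear_covering (F : fieldType) (V : vectType F)
    (S : {vspace V} -> Prop) : Prop :=
  [/\ (2 <= \dim {:V})%N,
      forall U : {vspace V}, S U -> U <> fullv
    & forall v : V, exists2 U : {vspace V}, S U & v \in U].

Definition condition1 (q : nat) (C : {fset int}) : Prop :=
  almost_every_prime (contains_qth_power_mod q C).

Definition condition2 (q : nat) (C : {fset int}) : Prop :=
  forall p : nat, prime p -> p <> q -> ~ (p %| \prod_(c <- enum_fset C) c)%Z ->
    contains_qth_power_mod q C p.

Definition condition3 (q : nat) (C : {fset int}) : Prop :=
  (2 <= dimk q C)%N /\
  exists S : {vspace 'rV['F_q]_(dimk q C)} -> Prop,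
    (forall U, S U -> hyperplanes U) /\ linear_covering S.

(* Main.v *)
(* All three conditions are insensitive to replacing c by c^n with n coprime
   to q.  Modulo a prime, u n - v q = 1 gives c = (c^n)^u / (c^q)^v, so c and c^n
   are q-th powers together.  In F_q^k, passing from c to c^n multiplies the
   coefficient vector of the hyperplane by the unit n, so the coordinates and
   the hyperplanes are unchanged. *)

Require Import Defs.
From mathcomp Require Import all_boot all_order all_algebra.
From mathcomp Require Import finmap.

Import GRing.Theory.

Local Open Scope ring_scope.

Lemma logn_prod_primes (s : seq nat) (f : nat -> nat) (r : nat) :
  uniq s -> all prime s ->
  logn r (\prod_(p <- s) p ^ f p)%N = if r \in s then f r else 0%N.
Proof.
have prod_gt0 s' : all prime s' -> (0 < \prod_(p <- s') p ^ f p)%N.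
  move=> /allP s'P; rewrite big_seq prodn_cond_gt0 // => p /s'P/prime_gt0.
  by rewrite expn_gt0 => ->.
elim: s => [|p s IHs] /=; first by rewrite big_nil logn1.
case/andP=> pNs us /andP[pP sP].
rewrite big_cons lognM ?prod_gt0 ?expn_gt0 ?prime_gt0 // lognX logn_prime //.
rewrite IHs // in_cons; case: eqP => [->|_] /=; last by rewrite muln0.
by rewrite (negPf pNs) muln1 addn0.
Qed.

(** At a prime that does not divide [b], and at a non-prime [r], both sides are 0. Later uses of
    [radq] see only these exponents modulo [q]. *)
Lemma logn_radq (q b r : nat) : logn r (radq q b) = (logn r b %% q)%N.
Proof.
rewrite /radq (@logn_prod_primes _ (fun p => (logn p b %% q)%N)) ?primes_uniq //.
  case: ifPn => //; rewrite -logn_gt0 -eqn0Ngt => /eqP ->.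
  by rewrite mod0n.
by apply/allP => p; rewrite mem_primes => /andP[].
Qed.

Lemma field_qth_power_exp (F : fieldType) (q n : nat) (c : F) :
    (0 < q)%N -> (0 < n)%N -> coprime q n ->
  (exists x, x ^+ q = c ^+ n) <-> (exists x, x ^+ q = c).
Proof.
move=> q_gt0 n_gt0 co_qn.
split=> -[x xq]; last by exists (x ^+ n); rewrite -xq exprAC.
(* Zero is treated apart because the witness below divides by a power of [c]. *)
have [->|c_neq0] := eqVneq c 0; first by exists 0; rewrite expr0n gtn_eqF.
have /(coprimeP _ n_gt0)[[u v] /= uv1] : coprime n q by rewrite coprime_sym.
(* Subtraction in [nat] truncates, but a difference equal to 1 forces [v * q < u * n], so the Bezout
   relation is a true equality. *)
have def_un : (u * n)%N = (v * q).+1.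
  by rewrite -(subnK (_ : v * q <= u * n)%N) ?uv1 // ltnW // -subn_gt0 uv1.
exists (x ^+ u / c ^+ v).
rewrite expr_div_n exprAC xq -!exprM [(n * u)%N]mulnC def_un exprS mulfK //.
exact: expf_neq0.
Qed.

(** Congruences are moved to the field ['F_p], where division is available. *)
Lemma qth_power_mod_Fp (q p : nat) (c : int) : prime p ->
  (exists x : int, (x ^+ q = c %[mod p])%Z) <->
  (exists x : 'F_p, x ^+ q = c%:~R).
Proof.
move=> p_prime.
have modE (m m' : int) : (m = m' %[mod p])%Z <-> m%:~R = m'%:~R :> 'F_p.
  rewrite (rwP eqP) eqz_mod_dvd (dvdz_pcharf (pchar_Fp p_prime)).
  by rewrite rmorphB subr_eq0 -(rwP eqP).
split=> [[x /modE xq]|[x xq]]; first by exists x%:~R; rewrite -rmorphXn.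
by exists (x : nat)%:Z; apply/modE; rewrite rmorphXn /= -[_%:~R]/(_%:R) natr_Zp.
Qed.

Lemma qth_power_mod_exp (q n p : nat) (c : int) :
    prime p -> (0 < q)%N -> (0 < n)%N -> coprime q n ->
  (exists x : int, (x ^+ q = c ^+ n %[mod p])%Z) <->
  (exists x : int, (x ^+ q = c %[mod p])%Z).
Proof.
move=> p_prime q_gt0 n_gt0 co_qn.
by rewrite !qth_power_mod_Fp // rmorphXn; apply: field_qth_power_exp.
Qed.

Lemma dvdz_prod_fset (p : nat) (C : {fset int}) : prime p ->
  (p %| \prod_(c <- enum_fset C) c)%Z <-> exists2 c, c \in C & (p %| c)%Z.
Proof.
move=> p_prime; rewrite dvdzE (big_morph absz abszM (erefl _)).
rewrite Euclid_dvd_prod // big_has; split=> [/hasP[c]|[c cC pc]].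
  by exists c; rewrite // dvdzE.
by apply/hasP; exists c; rewrite // -dvdzE.
Qed.

Section Covering.

Variables (q : nat) (q_prime : prime q).

Lemma natrF_eq0 (m : nat) : (m%:R == 0 :> 'F_q) = (m %% q == 0)%N.
Proof. by rewrite -(dvdn_pcharf (pchar_Fp q_prime)). Qed.

(** A prime divides the [q]-free part exactly when its exponent is nonzero modulo [q], so the
    coordinates depend only on valuations read in ['F_q]. *)
Lemma mem_rad_primes (C : {fset int}) (r : nat) :
  reflect (exists2 c, c \in C & (logn r `|c|%N)%:R != 0 :> 'F_q)
          (r \in rad_primes q C).
Proof.
rewrite mem_undup; apply: (iffP flatten_mapP) => -[c cC].
  by rewrite -logn_gt0 logn_radq lt0n => rc; exists c; rewrite // natrF_eq0.
by rewrite natrF_eq0 => rc; exists c; rewrite // -logn_gt0 logn_radq lt0n.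
Qed.

Lemma nu_natr (C : {fset int}) (c : int) (i : 'I_(dimk q C)) :
  (nu c i)%:R = (logn (nth 0%N (rad_primes q C) i) `|c|%N)%:R :> 'F_q.
Proof. by rewrite /nu logn_radq GRing.natr_mod_pchar ?pchar_Fp. Qed.

(** Indexing by primes instead of ordinals lets equations attached to different sets be compared,
    although their ambient spaces are different types. *)
Lemma sum_nu (C : {fset int}) (c : int) (v : nat -> 'F_q) :
  \sum_(i < dimk q C) (nu c i)%:R * v (nth 0%N (rad_primes q C) i) =
  \sum_(r <- rad_primes q C) (logn r `|c|%N)%:R * v r.
Proof.
rewrite (big_nth 0%N) big_mkord.
by apply: eq_bigr => i _; rewrite nu_natr.
Qed.

(* The clause [exists r, _] says that the hyperplane of c is a proper subspace. *)
Lemma condition3P (C : {fset int}) :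
  condition3 q C <->
  (2 <= dimk q C)%N /\
  forall v : nat -> 'F_q, exists c : int,
    [/\ c \in C, exists r, (logn r `|c|%N)%:R != 0 :> 'F_q
      & \sum_(r <- rad_primes q C) (logn r `|c|%N)%:R * v r = 0].
Proof.
set s := rad_primes q C; set k := dimk q C.
split=> -[k_ge2].
  case=> S [S_hyp [_ S_proper S_cover]]; split=> // v.
  have [U SU vU] := S_cover (\row_i v (nth 0%N s i)).
  have [c cC Uc] := S_hyp U SU; exists c; split=> //.
    (* If every coefficient vanished in ['F_q], the equation would be trivial and [U] the full
       space, against properness. *)
    have [/existsP[i ci]|/existsPn c0] :=
        boolP [exists i : 'I_k, (nu c i)%:R != 0 :> 'F_q].
      by exists (nth 0%N s i); rewrite -nu_natr.
    case: (S_proper U SU); apply/vspaceP=> x; rewrite memvf.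
    apply/Uc/big1 => i _; have := c0 i; rewrite negbK => /eqP ->.
    by rewrite mul0r.
  rewrite -sum_nu -[RHS]((Uc _).1 vU).
  by apply: eq_bigr => i _; rewrite mxE.
move=> cover; split=> //.
(* The largest candidate: all associated hyperplanes that are proper. *)
exists (fun U => hyperplanes U /\ U <> fullv).
split=> [U []//|]; split=> [|U []//|x].
  by rewrite dimvf dim_matrix mul1r.
(* The point [x] becomes a function on all naturals, with value 0 outside [s], where [index r s] is
   too large to be an ordinal below [k]. *)
pose v r := oapp (x 0) 0 (insub (index r s)).
have vE (i : 'I_k) : v (nth 0%N s i) = x 0 i.
  by rewrite /v index_uniq ?undup_uniq // valK.
have [c [cC [r cr] c_v]] := cover v.
pose w : 'cV['F_q]_k := \col_i (nu c i)%:R.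
(* The hyperplane of [c] is realised as the kernel of the linear form with coefficient column
   [w]. *)
pose U := lker (linfun (mulmxr w) : 'Hom('rV['F_q]_k, 'rV['F_q]_1)).
have UE (y : 'rV['F_q]_k) :
    y \in U <-> \sum_(i < k) (nu c i)%:R * y 0 i = 0.
  have yw : (y *m w) 0 0 = \sum_(i < k) (nu c i)%:R * y 0 i.
    by rewrite mxE; apply: eq_bigr => i _; rewrite mxE mulrC.
  rewrite memv_ker lfunE /= -yw -(rwP eqP); split=> [->|yw0]; first by rewrite mxE.
  by apply/rowP=> j; rewrite ord1 yw0 mxE.
exists U; last first.
  apply/UE; rewrite -[RHS]c_v -sum_nu.
  by apply: eq_bigr => i _; rewrite vE.
split=> [|Ufull]; first by exists c.
have r_s : r \in s by apply/mem_rad_primes; exists c.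
have r_lt : (index r s < k)%N by rewrite index_mem.
(* The basis vector at [r] would lie in [U], but the form takes there the nonzero value given by the
   valuation of [c] at [r]. *)
have /UE : delta_mx 0 (Ordinal r_lt) \in U by rewrite Ufull memvf.
rewrite (bigD1 (Ordinal r_lt)) //= big1 ?addr0 => [|i iNr].
  by rewrite mxE !eqxx mulr1 nu_natr nth_index // => /eqP; rewrite (negPf cr).
by rewrite mxE eqxx (negPf iNr) mulr0.
Qed.

(** Proportional coefficient vectors with a nonzero factor define the same hyperplane. Quantifying
    over all [r] keeps the relation independent of any ambient set. *)
Definition valuations_proportional (c c' : int) :=
  exists2 t : 'F_q, t != 0 &
    forall r, (logn r `|c'|%N)%:R = t * (logn r `|c|%N)%:R.

Lemma valuations_proportional_sym (c c' : int) :
  valuations_proportional c c' -> valuations_proportional c' c.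
Proof.
case=> t t_neq0 cc'; exists t^-1 => [|r]; first by rewrite invr_eq0.
by rewrite cc' mulKf.
Qed.

Lemma rad_primes_sub (C C' : {fset int}) :
    (forall c, c \in C -> exists2 c', c' \in C' & valuations_proportional c c') ->
  {subset rad_primes q C <= rad_primes q C'}.
Proof.
move=> CC' r /mem_rad_primes[c /CC'[c' c'C' [t t_neq0 cc']] cr].
by apply/mem_rad_primes; exists c'; rewrite // cc' mulf_neq0.
Qed.

(** A point is a function on all naturals, so the same [v] can be tested for both sets: the equation
    of [c] at [v] is multiplied by [t]. *)
Lemma condition3_proportional (C C' : {fset int}) :
    (forall c, c \in C -> exists2 c', c' \in C' & valuations_proportional c c') ->
    (forall c', c' \in C' -> exists2 c, c \in C & valuations_proportional c' c) ->
  condition3 q C -> condition3 q C'.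
Proof.
move=> CC' C'C /condition3P[k_ge2 cover]; apply/condition3P.
(* The two lists contain the same primes but may order them differently. *)
have eq_rad : perm_eq (rad_primes q C) (rad_primes q C').
  apply: uniq_perm; rewrite ?undup_uniq // => r.
  by apply/idP/idP; apply: rad_primes_sub.
split=> [|v]; first by rewrite /dimk -(perm_size eq_rad).
have [c [cC [r cr] c_v]] := cover v.
have [c' c'C' [t t_neq0 cc']] := CC' c cC; exists c'; split=> //.
  by exists r; rewrite cc' mulf_neq0.
rewrite -(perm_big _ eq_rad) /= -[RHS](mulr0 t) -[in RHS]c_v mulr_sumr.
by apply: eq_bigr => r' _; rewrite cc' mulrA.
Qed.

End Covering.

Theorem corollary2 (q : nat) (q_prime : prime q) (q_odd : odd q)
    (l : nat) (b : 'I_l -> int) (b_neq0 : forall j : 'I_l, b j <> 0)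
    (a : 'I_l -> 'F_q) (a_neq0 : forall j : 'I_l, a j <> 0) :
  let B : {fset int} := [fset b j | j in 'I_l]%fset in
  let B' : {fset int} := [fset b j ^+ nat_of_ord (a j) | j in 'I_l]%fset in
  [/\ condition1 q B <-> condition1 q B',
      condition2 q B <-> condition2 q B'
    & condition3 q B <-> condition3 q B'].
Proof.
move=> B B'.
have q_gt0 := prime_gt0 q_prime.
have a_gt0 j : (0 < a j)%N.
  by rewrite lt0n; apply/eqP => aj0; apply: (a_neq0 j); apply: val_inj.
have co_qa j : coprime q (a j).
  (* The representative satisfies [0 < a j < q], so [q] cannot divide it. *)
  by rewrite prime_coprime // gtnNdvd // -[X in (_ < X)%N](Fp_cast q_prime) ltn_ord.
have BP c : reflect (exists j, c = b j) (c \in B).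
  by apply: (iffP (imfsetP _ _ _ _)) => [[j _ ->]|[j ->]]; exists j.
have B'P c : reflect (exists j, c = b j ^+ a j) (c \in B').
  by apply: (iffP (imfsetP _ _ _ _)) => [[j _ ->]|[j ->]]; exists j.
have powBB' p : prime p ->
    contains_qth_power_mod q B p <-> contains_qth_power_mod q B' p.
  move=> p_prime.
  have powE j :=
    qth_power_mod_exp q (a j) p (b j) p_prime q_gt0 (a_gt0 j) (co_qa j).
  split=> [[_ /BP[j ->] /powE bj]|[_ /B'P[j ->] /powE bj]].
    by exists (b j ^+ a j); first by apply/B'P; exists j.
  by exists (b j); first by apply/BP; exists j.
(* Condition 2 excludes the same primes for both sets, since the exponents [a j] are positive. *)
have dvdBB' p : prime p ->
    (p %| \prod_(c <- enum_fset B) c)%Z <-> (p %| \prod_(c <- enum_fset B') c)%Z.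
  move=> p_prime; rewrite !dvdz_prod_fset //.
  split=> [[_ /BP[j ->] pb]|[_ /B'P[j ->] pb]].
    exists (b j ^+ a j); first by apply/B'P; exists j.
    by move: pb; rewrite !dvdzE abszX Euclid_dvdX // a_gt0 andbT.
  exists (b j); first by apply/BP; exists j.
  by move: pb; rewrite !dvdzE abszX Euclid_dvdX // a_gt0 andbT.
have propBB' j : valuations_proportional q (b j) (b j ^+ a j).
  (* The factor is [a j] itself, as an element of ['F_q]. *)
  exists (a j); first exact/eqP.
  by move=> r; rewrite abszX lognX natrM natr_Zp.
split.
(* The same finite exceptional set [E] serves both directions. *)
- by split=> -[E EP]; exists E => p p_prime /(EP p p_prime)/(powBB' p p_prime).
- split=> cond p p_prime p_neq_q pNprod; apply/(powBB' p p_prime)/cond => //.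
    by move/(dvdBB' p p_prime).
  by move/(dvdBB' p p_prime).
split; apply: condition3_proportional => // c.
- by case/BP=> j ->; exists (b j ^+ a j); [apply/B'P; exists j|].
- case/B'P=> j ->; exists (b j); first by apply/BP; exists j.
  exact/valuations_proportional_sym.
- case/B'P=> j ->; exists (b j); first by apply/BP; exists j.
  exact/valuations_proportional_sym.
by case/BP=> j ->; exists (b j ^+ a j); [apply/B'P; exists j|].
Qed.
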